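(* There exist absolute constants $c_2>0$ and $x_0$ such that for every real $x\ge x_0$ the following holds: there exist distinct primes $q,r$ with $q\le 4x$ and $x^{1/2}\log x< r\le 2x^{1/2}\log x$ such that the number $qr^2\in B_3$ has at least $c_2\dfrac{x}{\log^4 x}$ different $C_3$-parents of the form $p_1p_2p_3$ with primes $x<p_i\le 2x$ $(i=1,2,3)$.
   Context: For an integer $n>1$, $P(n)$ denotes the largest prime factor of $n$. Let $C_3=\{p_1p_2p_3: p_1,p_2,p_3 \text{ primes}, p_i\ne p_j \text{ for } i\ne j\}$, and let $B_3$ be the set of products $p_1p_2p_3$ of three primes in which exactly two of the primes are equal (i.e. some two coincide but not all three). Let $A_3=C_3\cup B_3$. For $n=p_1p_2p_3\in A_3$ define $w(n)=P(p_1+p_2)\,P(p_1+p_3)\,P(p_2+p_3)$ (this is independent of the ordering of the prime factors, and $w(n)\in A_3$). For $n\in A_3$, an element $m\in A_3$ with $w(m)=n$ is called a parent of $n$; if moreover $m\in C_3$ it is called a $C_3$-parent of $n$. ''Different'' parents means different integers $m$. $\log$ is the natural logarithm. *)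

(* Defs.v *)
From mathcomp Require Import all_boot.
Set Implicit Arguments.
Unset Strict Implicit.
Unset Printing Implicit Defensive.

Definition C3 (n : nat) : Prop :=
  exists p1 p2 p3 : nat,
    [/\ [/\ prime p1, prime p2 & prime p3],
        [/\ p1 <> p2, p1 <> p3 & p2 <> p3]
      & n = p1 * p2 * p3].

Definition B3 (n : nat) : Prop :=
  exists p1 p2 p3 : nat,
    [/\ [/\ prime p1, prime p2 & prime p3],
        [\/ p1 = p2, p1 = p3 | p2 = p3],
        ~ (p1 = p2 /\ p2 = p3)
      & n = p1 * p2 * p3].

Definition A3 (n : nat) : Prop := C3 n \/ B3 n.

(* The prime factors of [n], listed with multiplicity in increasing order. *)
Definition prime_factors (n : nat) : seq nat :=
  flatten [seq nseq (logn p n) p | p <- primes n].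

(* Only meaningful on [A3]; [wE] gives its value on an arbitrary, possibly
   unordered, factorization. *)
Definition w (n : nat) : nat :=
  if prime_factors n is [:: p1; p2; p3]
  then max_pdiv (p1 + p2) * max_pdiv (p1 + p3) * max_pdiv (p2 + p3) else 0.

Lemma count_prime_factors (p n : nat) :
  count_mem p (prime_factors n) = logn p n.
Proof.
have aux s : uniq s ->
    count_mem p (flatten [seq nseq (logn q n) q | q <- s])
      = (p \in s) * logn p n.
  elim: s => //= q s IHs /andP[qs us].
  rewrite count_cat count_nseq IHs // in_cons /= (eq_sym p).
  by case: eqVneq => [<-|_] //=; rewrite (negPf qs) mul0n addn0.
rewrite aux ?primes_uniq //.
by rewrite -logn_gt0; case: (logn p n) => [|k] //=; rewrite mul1n.
Qed.

Lemma prime_factors3 (p1 p2 p3 : nat) : prime p1 -> prime p2 -> prime p3 ->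
  perm_eq (prime_factors (p1 * p2 * p3)) [:: p1; p2; p3].
Proof.
move=> pr1 pr2 pr3; apply/allP => p _ /=; apply/eqP.
have [g1 g2 g3] := And3 (prime_gt0 pr1) (prime_gt0 pr2) (prime_gt0 pr3).
have E q : prime q -> logn p q = (q == p).
  move=> prq; case: (boolP (prime p)) => [prp|nprp].
    by rewrite logn_prime // eq_sym.
  rewrite lognE (negPf nprp) /=; case: eqVneq => // eqp.
  by rewrite -eqp prq in nprp.
by rewrite count_prime_factors !lognM ?muln_gt0 ?g1 ?g2 // !E // addn0 addnA.
Qed.

Lemma wE (p1 p2 p3 : nat) : prime p1 -> prime p2 -> prime p3 ->
  w (p1 * p2 * p3)
    = max_pdiv (p1 + p2) * max_pdiv (p1 + p3) * max_pdiv (p2 + p3).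
Proof.
move=> pr1 pr2 pr3; have := prime_factors3 pr1 pr2 pr3; rewrite /w.
move/[dup]/perm_size.
case: (prime_factors _) => [|a [|b [|c [|]]]] //= _ H.
have two u v s t : perm_eq [:: u; v] [:: s; t] ->
    (u = s /\ v = t) \/ (u = t /\ v = s).
  have swap : perm_eq [:: u; v] [:: v; u] by apply/permPl; exact: perm_catC [:: u] [:: v].
  move=> uv; have : s \in [:: u; v] by rewrite (perm_mem uv) mem_head.
  rewrite !inE => /orP[]/eqP e; subst s; [left|right]; split=> //.
    by move: uv; rewrite perm_cons => /perm_mem/(_ v); rewrite !inE eqxx => /esym/eqP.
  rewrite perm_sym in swap; move: (perm_trans swap uv).
  by rewrite perm_cons => /perm_mem/(_ u); rewrite !inE eqxx => /esym/eqP.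
have : p1 \in [:: a; b; c] by rewrite (perm_mem H) mem_head.
rewrite !inE => /or3P[]/eqP e; subst p1.
- move: H; rewrite perm_cons => /two[][-> ->] //.
  by rewrite (addnC p3) [X in X * _ = _]mulnC.
- have /perm_trans/(_ H) : perm_eq [:: b; a; c] [:: a; b; c].
    by apply/permPl; exact: perm_catCA [:: b] [:: a] [:: c].
  rewrite perm_cons => /two[][-> ->]; first by rewrite (addnC p2) mulnAC.
  by rewrite (addnC p3 b) (addnC p3 p2) mulnAC [X in X * _]mulnC mulnAC mulnC mulnA mulnAC.
- have /perm_trans/(_ H) : perm_eq [:: c; a; b] [:: a; b; c].
    by apply/permPl; exact: perm_catC [:: c] [:: a; b].
  rewrite perm_cons => /two[][-> ->]; rewrite !(addnC _ c).
    by rewrite -mulnA mulnC.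
  by rewrite (addnC p3 p2) mulnC mulnA mulnAC.
Qed.

(* [parent n m]: [m] is a parent of [n], for [n] in [A3]. *)
Definition parent (n m : nat) : Prop := A3 m /\ w m = n.

Definition C3_parent (n m : nat) : Prop := parent n m /\ C3 m.

(* Main.v *)
Require Import Defs.
From HB Require Import structures.
From mathcomp Require Import all_boot all_order all_algebra.
From mathcomp Require Import all_classical all_reals all_analysis.
From mathcomp Require Import ring lra zify.
Import Order.TTheory GRing.Theory Num.Theory.
Local Open Scope ring_scope.

(* Let [A] be the set of primes in (x, 2x], [Z] its size and
   rho = x^(1/2) log x.  If a prime r in (rho, 2 rho] divides both p1 + p2 and
   p1 + p3 then P(p1 + p2) = P(p1 + p3) = r, because the cofactors are below r;
   so w(p1 p2 p3) = q r^2 with q = P(p2 + p3) <= 4x, and the triples are shared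
   out among the O(x / log x) primes q.  It remains to find an r having at
   least c x^2 / log^5 x such triples, which by Cauchy-Schwarz holds as soon as
   A is well distributed modulo r in mean square.  Since r exceeds x^(1/2), this
   is a matter for the large sieve; a weak form, with an elementary proof,
   suffices.  Put T_r(n) = #{m in A : m = n mod r} - Z/r and
   V_r = sum_(n in A) T_r(n) = sum_(c mod r) T_r(c)^2.  By Cauchy-Schwarz the
   square of sum_r V_r is at most Z sum_(n in A) (sum_r T_r(n))^2.  Replace the
   sum over A by a sum against a tent function of length about x log^6 x: the
   diagonal terms remain acceptable, and the product T_r T_r', which has mean 0
   over the period r r', contributes an amount that does not depend on the
   length of the tent.  *)

(** * Mean-square distribution in residue classes *)

Section Periodic.
Context {F : realFieldType}.
Implicit Types (f : nat -> F) (P i j M : nat).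

Definition mod_periodic P f := forall i, f (i + P)%N = f i.

Lemma periodicM P f k i : mod_periodic P f -> f (i + k * P)%N = f i.
Proof. by move=> pf; elim: k => [|k IH]; rewrite ?addn0 // mulSn addnCA addnC pf. Qed.

Lemma periodic_mod P f i : mod_periodic P f -> f (i %% P)%N = f i.
Proof. by move=> pf; rewrite [in RHS](divn_eq i P) addnC periodicM. Qed.

(** Sliding the window by one place trades [f i] for [f (i + P)]. *)
Lemma sum_period_shift P f i : mod_periodic P f ->
  \sum_(j < P) f (i + j)%N = \sum_(j < P) f j.
Proof.
move=> pf; elim: i => [|i IH]; first by apply: eq_bigr => j _; rewrite add0n.
rewrite -IH; case: P pf {IH} => [|P] pf; first by rewrite !big_ord0.
rewrite big_ord_recr [in RHS]big_ord_recl /= addrC; congr (_ + _).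
  by rewrite addSnnS pf addn0.
by apply: eq_bigr => j _; rewrite addSnnS.
Qed.

Lemma sum_periods P f k i : mod_periodic P f ->
  \sum_(j < k * P) f (i + j)%N = (\sum_(j < P) f j) *+ k.
Proof.
move=> pf; elim: k => [|k IH]; first by rewrite mul0n big_ord0.
rewrite mulSn big_split_ord /= sum_period_shift // mulrS; congr (_ + _).
by rewrite -IH; apply: eq_bigr => j _; rewrite addnCA addnC pf.
Qed.

Lemma sum_periodic_mod P f M i : mod_periodic P f -> \sum_(j < P) f j = 0 ->
  \sum_(j < M) f (i + j)%N = \sum_(j < M %% P) f (i + j)%N.
Proof.
move=> pf f0; have -> : \sum_(j < M) f (i + j)%N =
  \sum_(j < M %/ P * P + M %% P) f (i + j)%N by rewrite -divn_eq.
rewrite big_split_ord /= sum_periods // f0 mul0rn.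
by rewrite add0r; apply: eq_bigr => j _; rewrite addnCA addnC periodicM.
Qed.

(* Averaging a mean-zero periodic function over [i + j], i.e. against a tent
   function, costs a bound independent of the length of the tent. *)
Lemma sum_tent_periodic P f M : (0 < P)%N -> mod_periodic P f ->
  \sum_(j < P) f j = 0 ->
  \sum_(i < M) \sum_(j < M) f (i + j)%N <= P%:R * \sum_(j < P) `|f j|.
Proof.
move=> P0 pf f0.
(* Whole periods cancel, so the inner sum keeps [M %% P] terms; after the exchange the same happens
   to the outer sum. What remains is a square of side below [P], each row of which is at most a
   full-period sum of absolute values. *)
under eq_bigr do rewrite (sum_periodic_mod P) //.
rewrite exchange_big /=.
have -> : \sum_(j < M %% P) \sum_(i < M) f (i + j)%N =
          \sum_(j < M %% P) \sum_(i < M %% P) f (j + i)%N.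
  apply: eq_bigr => j _; rewrite -(sum_periodic_mod P) //.
  by apply: eq_bigr => i _; rewrite addnC.
have pn : mod_periodic P (fun i => `|f i|) by move=> i; rewrite pf.
have ltP : (M %% P <= P)%N by rewrite ltnW // ltn_pmod.
apply: (@le_trans _ _ (\sum_(j < M %% P) \sum_(i < P) `|f i|)).
  apply: ler_sum => j _; rewrite -(sum_period_shift P _ j pn).
  rewrite (big_ord_widen _ (fun i => f (j + i)%N) ltP) big_mkcond /=.
  apply: ler_sum => i _; case: ifP => _; [exact: ler_norm|exact: normr_ge0].
rewrite sumr_const card_ord -[leLHS]mulr_natl ler_wpM2r ?ler_nat //.
by apply: sumr_ge0.
Qed.

End Periodic.

(** * Discrepancies modulo r and their correlations *)

Section Discrepancy.
Context {F : realFieldType}.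
Implicit Types (A : seq nat) (r n : nat).

Definition disc A r n : F :=
  \sum_(m <- A) ((n == m %[mod r])%:R - r%:R^-1).

(** This form is linear in the discrepancy, so it can be summed over [r] before Cauchy-Schwarz is
    applied; [sum_disc_sqr] recovers the sum of squares over residues. *)
Definition variance A r : F := \sum_(n <- A) disc A r n.

Lemma disc_periodic A r : mod_periodic r (disc A r).
Proof. by move=> i; apply: eq_bigr => m _; rewrite modnDr. Qed.

Lemma sum_eq_mod r m : (0 < r)%N -> forall f : nat -> F, 
  \sum_(c < r) (c == m %[mod r])%:R * f c = f (m %% r)%N.
Proof.
move=> r0 f; have lt : (m %% r < r)%N by rewrite ltn_pmod.
rewrite (bigD1 (Ordinal lt)) //= modn_mod eqxx mul1r big1 ?addr0 // => i ne.
rewrite modn_small // (_ : _ == _ = false) ?mul0r //.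
by apply: negbTE; apply: contraNneq ne => e; apply/eqP/val_inj.
Qed.

Lemma sum_disc A r : (0 < r)%N -> \sum_(c < r) disc A r c = 0.
Proof.
move=> r0; rewrite /disc exchange_big big1 // => m _; rewrite sumrB.
have := sum_eq_mod r m r0 (fun=> 1); under eq_bigr do rewrite mulr1.
move=> ->; rewrite sumr_const card_ord -[_^-1 *+ _]mulr_natl divff ?subrr //.
by rewrite pnatr_eq0 -lt0n.
Qed.

(** The indicator of the class of [m] picks out [f m], and the constant [1/r] is annihilated by the
    zero mean of [f]. Sums over residues thus become sums over [A]. *)
Lemma sum_disc_mul A r (f : nat -> F) : (0 < r)%N -> mod_periodic r f ->
  \sum_(c < r) f c = 0 ->
  \sum_(c < r) disc A r c * f c = \sum_(n <- A) f n.
Proof.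
move=> r0 pf f0; under eq_bigr do rewrite /disc mulr_suml.
rewrite exchange_big; apply: eq_bigr => m _.
under eq_bigr do rewrite mulrBl.
by rewrite sumrB sum_eq_mod // -mulr_sumr f0 mulr0 subr0 periodic_mod.
Qed.

Lemma sum_disc_sqr A r : (0 < r)%N ->
  \sum_(c < r) disc A r c ^+ 2 = variance A r.
Proof.
move=> r0; rewrite /variance -(sum_disc_mul A r (disc A r)) ?sum_disc //;
  exact: disc_periodic.
Qed.

Lemma variance_ge0 A r : (0 < r)%N -> 0 <= variance A r.
Proof. by move=> r0; rewrite -sum_disc_sqr // sumr_ge0 // => i _; rewrite sqr_ge0. Qed.

Lemma varianceE A r : variance A r =
  \sum_(n <- A) \sum_(m <- A) (n == m %[mod r])%:R - (size A)%:R ^+ 2 / r%:R.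
Proof.
rewrite /variance /disc; under eq_bigr do rewrite sumrB.
rewrite sumrB; congr (_ - _).
by rewrite !big_const_seq !count_predT !iter_addr_0 -mulr_natr -[_ *+ _ in
  LHS]mulr_natr; ring.
Qed.

Lemma variance_shift A r k : variance [seq (n + k)%N | n <- A] r = variance A r.
Proof.
rewrite !varianceE size_map big_map; congr (_ - _).
by apply: eq_bigr => n _; rewrite big_map; apply: eq_bigr => m _; rewrite eqn_modDr.
Qed.

(** By the Chinese remainder theorem the two residues vary independently, so the sum factors into
    two sums that vanish. *)
Lemma sum_disc_mul_coprime A r r' : (0 < r)%N -> (0 < r')%N -> coprime r r' ->
  \sum_(c < r * r') disc A r c * disc A r' c = 0.
Proof.
move=> r0 r'0 co.
pose h (c : nat) : 'I_r * 'I_r' :=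
  (Ordinal (ltn_pmod c r0), Ordinal (ltn_pmod c r'0)).
have bij : bijective (fun c : 'I_(r * r') => h c).
  apply: inj_card_bij; last by rewrite card_prod !card_ord.
  move=> c d [e1 e2]; apply: val_inj.
  have : c == d %[mod r * r'] by rewrite chinese_remainder //= e1 e2 !eqxx.
  by move/eqP; rewrite !modn_small.
under eq_bigr => c _ do rewrite -(periodic_mod r (disc A r) c (disc_periodic A r)) 
  -(periodic_mod r' (disc A r') c (disc_periodic A r')).
rewrite -(reindex (fun c : 'I_(r * r') => h c) (P := predT)
  (F := fun p : 'I_r * 'I_r' => disc A r p.1 * disc A r' p.2)) /=; last exact: onW_bij.
rewrite -(pair_bigA _ (fun (i : 'I_r) (j : 'I_r') => disc A r i * disc A r' j)) /=.
by under eq_bigr do rewrite -mulr_sumr sum_disc // mulr0; rewrite big1.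
Qed.

(** [sum_tent_periodic] applies with period [r * r']. The absolute value of the product is at most
    half the sum of the squares, and the square of [disc A r] runs through [r'] periods, which gives
    [r'] times its variance. *)
Lemma sum_tent_disc A r r' M : (0 < r)%N -> (0 < r')%N -> coprime r r' ->
  \sum_(i < M) \sum_(j < M) disc A r (i + j) * disc A r' (i + j) <=
  (r * r')%:R * ((r'%:R * variance A r + r%:R * variance A r') / 2).
Proof.
move=> r0 r'0 co.
have p1 : mod_periodic (r * r') (disc A r).
  by move=> i; rewrite mulnC periodicM //; exact: disc_periodic.
have p2 : mod_periodic (r * r') (disc A r').
  by move=> i; rewrite periodicM //; exact: disc_periodic.
apply: le_trans (sum_tent_periodic (r * r')%N (fun n =>
  disc A r n * disc A r' n) M _ _ _) _.
- by rewrite muln_gt0 r0.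
- by move=> i; rewrite p1 p2.
- exact: sum_disc_mul_coprime.
rewrite ler_wpM2l //.
have -> : r'%:R * variance A r = \sum_(c < r * r') disc A r c ^+ 2.
  rewrite mulnC -sum_disc_sqr //.
  have := sum_periods r (fun c => disc A r c ^+ 2) r' 0%N.
  by rewrite mulr_natl => ->// i; rewrite disc_periodic.
have -> : r%:R * variance A r' = \sum_(c < r * r') disc A r' c ^+ 2.
  rewrite -sum_disc_sqr //.
  have := sum_periods r' (fun c => disc A r' c ^+ 2) r 0%N.
  by rewrite mulr_natl => ->// i; rewrite disc_periodic.
rewrite -big_split mulr_suml /=; apply: ler_sum => c _.
rewrite normrM -(real_normK (num_real (disc A r c))) -(real_normK (num_real (disc A r' c))).
have := sqr_ge0 (`|disc A r c| - `|disc A r' c|); lra.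
Qed.

(** Squares do not cancel; each window of length [M] is covered by [(M %/ r).+1] whole periods. *)
Lemma sum_tent_disc_sqr A r M : (0 < r)%N ->
  \sum_(i < M) \sum_(j < M) disc A r (i + j) * disc A r (i + j) <=
  M%:R * ((M %/ r).+1%:R * variance A r).
Proof.
move=> r0; have pd := disc_periodic A r.
apply: (@le_trans _ _ (\sum_(i < M) (M %/ r).+1%:R * variance A r)); last first.
  by rewrite sumr_const card_ord -[leLHS]mulr_natl.
apply: ler_sum => i _; rewrite -sum_disc_sqr //.
have pp : mod_periodic r (fun c => disc A r c ^+ 2) by move=> c; rewrite pd.
rewrite mulr_natl -(sum_periods r _ (M %/ r).+1 i pp).
have le : (M <= (M %/ r).+1 * r)%N by rewrite ltnW // ltn_ceil.
rewrite (big_ord_widen _ (fun j => disc A r (i + j)%N * disc A r (i + j)%N) le) big_mkcond.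
by apply: ler_sum => j _; case: ifP => _; rewrite ?sqr_ge0.
Qed.

End Discrepancy.

(** * A weak large sieve inequality *)

Section LargeSieve.
Context {F : realFieldType}.

(** Cauchy-Schwarz against the constant 1, read off from the double sum of squared differences. *)
Lemma sqr_sum_le (I : Type) (s : seq I) (f : I -> F) :
  (\sum_(i <- s) f i) ^+ 2 <= (size s)%:R * \sum_(i <- s) f i ^+ 2.
Proof.
have h : 0 <= \sum_(i <- s) \sum_(j <- s) (f i - f j) ^+ 2.
  by apply: sumr_ge0 => i _; apply: sumr_ge0 => j _; rewrite sqr_ge0.
suff e : \sum_(i <- s) \sum_(j <- s) (f i - f j) ^+ 2 =
  2 * ((size s)%:R * \sum_(i <- s) f i ^+ 2) - 2 * (\sum_(i <- s) f i) ^+ 2 by lra.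
set X := \sum_(i <- s) f i; set Y := \sum_(i <- s) f i ^+ 2.
have e i : \sum_(j <- s) (f i - f j) ^+ 2 = (size s)%:R * f i ^+ 2 - (2 * X) * f i + Y.
  under eq_bigr => j _.
    have -> : (f i - f j) ^+ 2 = f i ^+ 2 - (2 * f i) * f j + f j ^+ 2 by ring.
    over.
  rewrite big_split sumrB /= big_const_seq count_predT iter_addr_0 -mulr_sumr.
  by rewrite -[_ *+ size s]mulr_natl -/X -/Y; ring.
under eq_bigr do rewrite e.
rewrite big_split sumrB /= big_const_seq count_predT iter_addr_0 -!mulr_sumr.
by rewrite -[_ *+ size s]mulr_natl -/X -/Y; ring.
Qed.

Lemma sum_subseq_interval_le (A : seq nat) (a L : nat) (g : nat -> F) :
  uniq A -> (forall n, n \in A -> (a <= n < a + L)%N) -> (forall n, 0 <= g n) ->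
  \sum_(n <- A) g n <= \sum_(j < L) g (a + j)%N.
Proof.
move=> uA hA g0.
have /(perm_big _) -> : perm_eq A [seq n <- iota a L | n \in A].
  apply: uniq_perm; rewrite ?filter_uniq ?iota_uniq // => n.
  by rewrite mem_filter mem_iota; case: (boolP (n \in A)) => // /hA ->.
rewrite big_filter /= -(big_mkord xpredT (fun j => g (a + j)%N)) big_mkcond /=.
rewrite -{1}(addn0 a) iotaDl big_map /index_iota subn0.
by apply: ler_sum => i _; case: ifP.
Qed.

(** Let X be the sum of the variances. Cauchy-Schwarz bounds X^2 by the second moment of [G] over
    [A], the tent bounds this moment by a multiple of X itself, and one factor X cancels. The
    position of [A] in [2K, 3K) keeps it where the tent is high. *)
Lemma sum_variance_le_shifted (A S : seq nat) (K : nat) (rho : F) :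
  uniq A -> (forall n, n \in A -> (2 * K <= n < 3 * K)%N) ->
  uniq S -> (forall r, r \in S -> prime r /\ rho <= r%:R <= 2 * rho) ->
  0 < rho -> rho <= K%:R ->
  \sum_(r <- S) variance (F := F) A r <=
  (size A)%:R * (8 * K%:R / rho + 8 * rho ^+ 3 * (size S)%:R / K%:R).
Proof.
move=> uA hA uS hS rho0 rhoK.
have K0 : 0 < K%:R :> F by apply: lt_le_trans rhoK.
pose V r : F := variance A r; pose G n : F := \sum_(r <- S) disc A r n.
set X := \sum_(r <- S) _; set s := (size S)%:R; set Z := (size A)%:R.
have V0 r : r \in S -> 0 <= V r by case/hS => /prime_gt0 + _; exact: variance_ge0.
have X0 : 0 <= X by rewrite /X big_seq; apply: sumr_ge0 => r /V0.
have XG : X = \sum_(n <- A) G n by rewrite exchange_big.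
have cs : X ^+ 2 <= Z * \sum_(n <- A) G n ^+ 2 by rewrite XG; exact: sqr_sum_le.
pose Q r r' : F := \sum_(i < 2 * K) \sum_(j < 2 * K) disc A r (i + j) * disc A r' (i + j).
(* The tent has weight at least K on [2K, 3K): for such n, every i in [K, 2K) leaves n - i in [0,
   2K). *)
have low : K%:R * \sum_(n <- A) G n ^+ 2 <=
           \sum_(i < 2 * K) \sum_(j < 2 * K) G (i + j)%N ^+ 2.
  rewrite mulr_natl.
  have -> : \sum_(i < 2 * K) \sum_(j < 2 * K) G (i + j)%N ^+ 2 =
            \sum_(i < K + K) \sum_(j < 2 * K) G (i + j)%N ^+ 2 by rewrite addnn -mul2n.
  rewrite big_split_ord /= -[leLHS]add0r lerD //.
    by apply: sumr_ge0 => i _; apply: sumr_ge0 => j _; rewrite sqr_ge0.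
  rewrite -[in leLHS](card_ord K) -sumr_const; apply: ler_sum => i _.
  apply: (sum_subseq_interval_le A (K + i) (2 * K) (fun n => G n ^+ 2)) => // n.
    by move/hA; have := ltn_ord i; lia.
  exact: sqr_ge0.
have expand : \sum_(i < 2 * K) \sum_(j < 2 * K) G (i + j)%N ^+ 2 =
              \sum_(r <- S) \sum_(r' <- S) Q r r'.
  rewrite /Q.
  under [RHS]eq_bigr do rewrite exchange_big.
  rewrite [RHS]exchange_big; apply: eq_bigr => i _.
  under [RHS]eq_bigr do rewrite exchange_big.
  rewrite [RHS]exchange_big; apply: eq_bigr => j _.
  by rewrite expr2 /G mulr_suml; apply: eq_bigr => r _; rewrite mulr_sumr.
have rle r : r \in S -> 0 < r%:R :> F /\ r%:R <= 2 * rho by case/hS => _ /andP[h1 h2]; lra.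
have r0 r : r \in S -> (0 < r)%N by case/hS => /prime_gt0.
(* On the diagonal, 2K/r + 1 is at most 4K/rho because rho <= K. Off the diagonal, [r] and [r'] are
   distinct primes of size at most 2 rho, so [sum_tent_disc] gives 4 rho^2 times rho (V + V'). *)
have Qle r r' : r \in S -> r' \in S ->
    Q r r' <= (r' == r)%:R * (8 * K%:R ^+ 2 / rho * V r) + 4 * rho ^+ 3 * (V r + V r').
  move=> rS r'S; have := V0 r rS; have := V0 r' r'S => V'0 V00.
  have rho3 : 0 <= rho ^+ 3 by rewrite exprn_ge0 // ltW.
  case: eqVneq => [->|ne]; rewrite ?mul1r ?mul0r ?add0r.
    rewrite -[leLHS]addr0 lerD //; last by apply: mulr_ge0;
      [apply: mulr_ge0|apply: addr_ge0].
    apply: le_trans (sum_tent_disc_sqr A r (2 * K) (r0 r rS)) _.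
    rewrite mulrA ler_wpM2r // (_ : 8 * _ / _ = (2 * K%:R) * (4 * K%:R / rho));
      last by ring.
    rewrite natrM ler_wpM2l // ?mulr_ge0 // ?ler0n //.
    rewrite ler_pdivlMr // -addn1 natrD mulrDl mul1r.
    have [h1 h2] := rle r rS; have /andP[h3 h4] := (hS r rS).2.
    have : (2 * K %/ r)%:R * rho <= 2 * K%:R.
      rewrite -natrM; apply: (@le_trans _ _ (2 * K %/ r * r)%:R);
        last by rewrite ler_nat leq_divM.
      by rewrite natrM ler_wpM2l.
    by lra.
  have co : coprime r r'.
    have [pr _] := hS r rS; have [pr' _] := hS r' r'S.
    by rewrite prime_coprime // dvdn_prime2 // eq_sym.
  apply: le_trans (sum_tent_disc A r r' (2 * K) (r0 r rS) (r0 r' r'S) co) _.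
  have [a1 a2] := rle r rS; have [b1 b2] := rle r' r'S.
  have m1 : r%:R * r'%:R <= (2 * rho) * (2 * rho) by apply: ler_pM; rewrite // ltW.
  have m2 : r'%:R * V r <= (2 * rho) * V r by rewrite ler_wpM2r.
  have m3 : r%:R * V r' <= (2 * rho) * V r' by rewrite ler_wpM2r.
  rewrite natrM -/(V r) -/(V r'); apply: (@le_trans _ _ ((2 * rho) * (2 * rho) * ((2 *
    rho * V r + 2 * rho * V r') / 2))).
    have d1 : 0 <= r'%:R * V r by rewrite mulr_ge0.
    have d2 : 0 <= r%:R * V r' by rewrite mulr_ge0.
    by apply: ler_pM; [rewrite mulr_ge0 ?ler0n|lra|exact: m1|lra].
  by rewrite le_eqVlt; apply/orP; left; apply/eqP; field.
have Qsum : \sum_(r <- S) \sum_(r' <- S) Q r r' <=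
  (8 * K%:R ^+ 2 / rho + 8 * rho ^+ 3 * s) * X.
  have sc (c : F) : \sum_(r <- S) c = s *
    c by rewrite big_const_seq count_predT iter_addr_0 mulr_natl.
  apply: (@le_trans _ _ (\sum_(r <- S) (8 * K%:R ^+ 2 / rho * V r +
    4 * rho ^+ 3 * (s * V r + X)))).
    rewrite big_seq [leRHS]big_seq; apply: ler_sum => r rS.
    apply: (@le_trans _ _ (\sum_(r' <- S) ((r' == r)%:R * (8 * K%:R ^+ 2 / rho * V r) +
      4 * rho ^+ 3 * (V r + V r')))).
      by rewrite big_seq [leRHS]big_seq; apply: ler_sum => r' r'S; exact: Qle.
    rewrite big_split -mulr_sumr big_split sc /= lerD //.
    rewrite (bigD1_seq r) //= eqxx mul1r big1 ?addr0 // => i /negPf ->.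
    by rewrite mul0r.
  rewrite big_split -!mulr_sumr big_split sc -mulr_sumr /= -/X -/s.
  by rewrite le_eqVlt; apply/orP; left; apply/eqP; ring.
(* The factor [X] can be cancelled only when it is nonzero. *)
have [->|Xn0] := eqVneq X 0.
  rewrite mulr_ge0 ?ler0n // addr_ge0 // ?mulr_ge0 ?invr_ge0 ?exprn_ge0 ?ler0n ?ltW //.
have Xp : 0 < X by rewrite lt_def Xn0.
rewrite -(ler_pM2r Xp) -(ler_pM2l K0).
have Z0 : 0 <= Z by exact: ler0n.
apply: (@le_trans _ _ (Z * (K%:R * \sum_(n <- A) G n ^+ 2))).
  have := ler_wpM2l (ltW K0) cs; rewrite expr2; lra.
apply: (@le_trans _ _ (Z * ((8 * K%:R ^+ 2 / rho + 8 * rho ^+ 3 * s) * X))).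
  by rewrite ler_wpM2l //; apply: le_trans low _; rewrite expand.
rewrite le_eqVlt; apply/orP; left; apply/eqP; field.
by rewrite !gt_eqF.
Qed.

(* The large sieve proper would give [Z * (K / rho + rho)] up to constants, with
   [Z = size A].  The weaker second term here is offset by taking [K] larger than
   the range of [A] requires. *)
Lemma sum_variance_le (A S : seq nat) (K : nat) (rho : F) :
  uniq A -> (forall n, n \in A -> (n < K)%N) ->
  uniq S -> (forall r, r \in S -> prime r /\ rho <= r%:R <= 2 * rho) ->
  0 < rho -> rho <= K%:R ->
  \sum_(r <- S) variance (F := F) A r <=
  (size A)%:R * (8 * K%:R / rho + 8 * rho ^+ 3 * (size S)%:R / K%:R).
Proof.
move=> uA hA uS hS rho0 rhoK.
under eq_bigr do rewrite -(variance_shift A _ (2 * K)).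
rewrite -(size_map (fun n => (n + 2 * K)%N) A).
apply: sum_variance_le_shifted => //; first by rewrite map_inj_uniq // => i j /addIn.
by move=> n /mapP[m /hA + ->]; lia.
Qed.

(** Averaging over [S]. The threshold is at most half of the main term Z^2/r of the pair count,
    since r <= 2 rho. *)
Lemma exists_small_variance (A S : seq nat) (K : nat) (rho : F) :
  uniq A -> (forall n, n \in A -> (n < K)%N) ->
  uniq S -> (forall r, r \in S -> prime r /\ rho <= r%:R <= 2 * rho) ->
  0 < rho -> rho <= K%:R -> (0 < size S)%N ->
  8 * K%:R / (size S)%:R + 8 * rho ^+ 4 / K%:R <= (size A)%:R / 4 ->
  exists2 r, r \in S & variance (F := F) A r <= (size A)%:R ^+ 2 / (4 * rho).
Proof.
move=> uA hA uS hS rho0 rhoK S0 small.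
have K0 : 0 < K%:R :> F by apply: lt_le_trans rhoK.
have s0 : 0 < (size S)%:R :> F by rewrite ltr0n.
have [/hasP[r rS h]|/hasPn h] := boolP (has (fun r =>
  variance A r <= (size A)%:R ^+ 2 / (4 * rho)) S).
  by exists r.
have := sum_variance_le A S K rho uA hA uS hS rho0 rhoK.
have : (size S)%:R * ((size A)%:R ^+ 2 / (4 * rho)) < \sum_(r <- S) variance A r.
  rewrite mulr_natl -(count_predT S) -iter_addr_0 -big_const_seq.
  rewrite big_seq [ltRHS]big_seq; apply: ltr_sum; last first.
    by move=> r /h; rewrite -ltNge.
  by case: (S) S0 => // a l _; apply/hasP; exists a; rewrite ?mem_head.
move=> /lt_le_trans/[apply]; rewrite ltNge => /negP[].
have -> : (size S)%:R * ((size A)%:R ^+ 2 / (4 * rho)) =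
   (size A)%:R * ((size S)%:R / rho * ((size A)%:R / 4)) :> F.
  by field; rewrite gt_eqF.
rewrite ler_wpM2l ?ler0n //.
have -> : 8 * K%:R / rho + 8 * rho ^+ 3 * (size S)%:R / K%:R =
   (size S)%:R / rho * (8 * K%:R / (size S)%:R + 8 * rho ^+ 4 / K%:R).
  by field; rewrite !gt_eqF.
by rewrite ler_wpM2l // divr_ge0 // ltW.
Qed.

End LargeSieve.

(** * Triples of primes and pigeonhole *)

Section Pairs.
Context {F : realFieldType}.

Lemma sum_periodic_opp r (f : nat -> F) : mod_periodic r f ->
  \sum_(c < r) f (r - c)%N = \sum_(c < r) f c.
Proof.
move=> pf; rewrite -(sum_period_shift r f 1 pf) (reindex_inj rev_ord_inj) /=.
by apply: eq_bigr => c _; congr f; have := ltn_ord c; lia.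
Qed.

Lemma eqn_mod_opp r n m : (0 < r)%N ->
  ((r - n %% r)%N == m %[mod r]) = (r %| n + m)%N.
Proof.
move=> r0; rewrite -(eqn_modDl (n %% r)) subnKC; last by rewrite ltnW // ltn_pmod.
by rewrite modnn modnDml eq_sym.
Qed.

(** The deviation of the pair count from its mean is the correlation of the discrepancy at c with
    that at -c, and this is at least minus the variance because (u + v)^2 >= 0. *)
Lemma sum_pairs_ge (A : seq nat) r : (0 < r)%N ->
  (size A)%:R ^+ 2 / r%:R - variance (F := F) A r <=
  \sum_(n <- A) \sum_(m <- A) (r %| n + m)%N%:R.
Proof.
(* [r - n %% r] represents the residue -n among the natural numbers. *)
move=> r0; pose g n : F := disc A r (r - n %% r).
have pd := disc_periodic (F := F) A r.
have gE (c : 'I_r) : g c = disc A r (r - c) by rewrite /g modn_small.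
have pg : mod_periodic r g by move=> n; rewrite /g modnDr.
have g0 : \sum_(c < r) g c = 0.
  by under eq_bigr do rewrite gE; rewrite sum_periodic_opp // sum_disc.
have g2 : \sum_(c < r) g c ^+ 2 = variance A r.
  under eq_bigr do rewrite gE.
  rewrite (sum_periodic_opp r (fun n => disc A r n ^+ 2)) ?sum_disc_sqr //.
  by move=> n; rewrite pd.
have : \sum_(n <- A) g n = \sum_(n <- A) \sum_(m <- A) (r %| n +
  m)%N%:R - (size A)%:R ^+ 2 / r%:R.
  have sc (c : F) : \sum_(n <- A) c = (size A)%:R * c.
    by rewrite big_const_seq count_predT iter_addr_0 mulr_natl.
  rewrite /g /disc; under eq_bigr => n _.
    rewrite sumrB sc; under eq_bigr do rewrite eqn_mod_opp //.
    over.
  by rewrite sumrB sc mulrA -expr2.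
rewrite -(sum_disc_mul A r g) // => e.
suff : - variance A r <= \sum_(c < r) disc A r c * g c by rewrite e; lra.
have -> : - variance A r = \sum_(c < r) (- (disc A r c ^+ 2) / 2 - g c ^+ 2 / 2).
  rewrite sumrB -!mulr_suml g2 sumrN sum_disc_sqr //; lra.
apply: ler_sum => c _; have := sqr_ge0 (disc A r c + g c); rewrite sqrrD; lra.
Qed.

End Pairs.

(** * Triples with two pair sums divisible by r *)

Section Cherries.
Local Open Scope nat_scope.

(** Paths of length two, with centre the first entry, in the graph joining elements whose sum is
    divisible by [r]. Only the two leaves are required to differ; [cherries_distinct] supplies the
    other inequalities. *)
Definition cherries (A : seq nat) (r : nat) : seq (nat * nat * nat) :=
  [seq t <- [seq (u, c) | u <- [seq (a, b) | a <- A, b <- A], c <- A] |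
    [&& r %| t.1.1 + t.1.2, r %| t.1.1 + t.2 & t.1.2 != t.2]].

Lemma cherries_uniq A r : uniq A -> uniq (cherries A r).
Proof.
move=> uA; rewrite filter_uniq // !allpairs_uniq //; first by move=> [a b] [c d].
by move=> [a b] [c d].
Qed.

Lemma mem_cherries A r a b c : ((a, b, c) \in cherries A r) =
  [&& a \in A, b \in A, c \in A, r %| a + b, r %| a + c & b != c].
Proof.
rewrite mem_filter /= andbC; apply/idP/idP.
  case/andP=> /allpairsP[[[a' b'] c']] /= [/allpairsP[[a2 b2]] /= [h1 h2 [-> ->]]
    h3 [-> -> ->]].
  by rewrite h1 h2 h3.
case/and4P=> h1 h2 h3 ->; rewrite andbT.
by apply/allpairsP; exists ((a, b), c); split=> //; apply/allpairsP; exists (a, b).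
Qed.

(** A centre of degree d carries d^2 - d ordered pairs of distinct leaves; the identity is stated
    additively to avoid truncated subtraction. *)
Lemma size_cherries A r : uniq A ->
  size (cherries A r) + \sum_(a <- A) count (fun b => r %| a + b) A =
  \sum_(a <- A) (count (fun b => r %| a + b) A) ^ 2.
Proof.
move=> uA; rewrite /cherries size_filter -sum1_count big_mkcond big_allpairs_dep
  big_allpairs_dep /=.
rewrite -big_split /=; apply: eq_bigr => a _.
rewrite -!sum1_count -mulnn big_distrl /= [in RHS]big_mkcond [X in _ +
  X]big_mkcond -big_split /=.
rewrite big_seq [RHS]big_seq; apply: eq_bigr => b bA.
case: ifP => rb /=; last by rewrite big1_eq.
rewrite mul1n [RHS]big_mkcond [RHS](bigD1_seq b) //= rb addnC; congr (_ + _).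
rewrite [RHS]big_mkcond /=; apply: eq_bigr => c _.
by rewrite (eq_sym c); case: (_ %| _); case: (_ != _).
Qed.

Lemma pigeonhole (T : Type) (s : seq T) (f : T -> nat) (D : seq nat) :
  uniq D -> all (fun t => f t \in D) s -> 0 < size s ->
  exists2 q, q \in D & size s <= size D * count (fun t => f t == q) s.
Proof.
move=> uD fD s0.
have [/hasP[q qD h]|/hasPn h] :=
  boolP (has (fun q => size s <= size D * count (fun t => f t == q) s) D).
  by exists q.
have D0 : 0 < size D.
  by case: s s0 fD {h} => // t s _ /= /andP[]; case: D {uD}.
have e : size s = \sum_(q <- D) count (fun t => f t == q) s.
  under eq_bigr do rewrite -sum1_count big_mkcond.
  rewrite exchange_big -sum1_size /=.
  elim: s fD {s0 h} => [|t s IH] /= => [_|/andP[tD /IH]];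
    rewrite ?big_nil // !big_cons => ->.
  congr (_ + _); rewrite (bigD1_seq (f t)) //= eqxx big1 // => q.
  by rewrite eq_sym => /negPf ->.
have : \sum_(q <- D) (size D * count (fun t => f t == q) s).+1 <= \sum_(q <- D) size s.
  by rewrite big_seq [leqRHS]big_seq; apply: leq_sum => q /h; rewrite -ltnNge.
under eq_bigr do rewrite -addn1.
rewrite big_split -big_distrr /= -e !big_const_seq count_predT !iter_addn_0.
by rewrite mul1n mulnC; lia.
Qed.

(** A prime divisor of [r * k] divides [r] or [k], so it is at most [r]. *)
Lemma max_pdiv_mul r k : prime r -> 0 < k <= r -> max_pdiv (r * k) = r.
Proof.
move=> pr /andP[k0 kr]; have r1 := prime_gt1 pr; have r0 := ltnW r1.
apply/eqP; rewrite eqn_leq andbC max_pdiv_max /=; last first.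
  by rewrite mem_primes pr muln_gt0 r0 k0 dvdn_mulr.
have h1 : 1 < r * k by rewrite (leq_trans r1) // leq_pmulr.
have := max_pdiv_dvd (r * k); rewrite Euclid_dvdM ?max_pdiv_prime //.
by case/orP=> /dvdn_leq => [/(_ r0) //|/(_ k0) /leq_trans]; apply.
Qed.

Lemma size_primes3 p1 p2 p3 : prime p1 -> prime p2 -> prime p3 ->
  size (primes (p1 * p2 * p3)) <= 3.
Proof.
move=> h1 h2 h3; apply: (@uniq_leq_size _ _ [:: p1; p2; p3]); first exact: primes_uniq.
move=> p; rewrite mem_primes => /and3P[pp _].
by rewrite !Euclid_dvdM // !dvdn_prime2 // !inE orbA.
Qed.

(** Each entry of a triple is one of the at most three primes dividing the product, so at most 3^3
    triples share a product. *)
Lemma size_prime_triples (s : seq (nat * nat * nat)) :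
  uniq s -> (forall t, t \in s -> [/\ prime t.1.1, prime t.1.2 & prime t.2]) ->
  size s <= 27 * size (undup [seq t.1.1 * t.1.2 * t.2 | t <- s]).
Proof.
move=> us ps; set S := undup _.
pose l := [seq [seq (u, c) | u <- [seq (a, b) |
  a <- primes m, b <- primes m], c <- primes m] | m <- S].
have sub : {subset s <= flatten l}.
  move=> [[a b] c] tin; have [/= pa pb pc] := ps _ tin.
  apply/flatten_mapP; exists (a * b * c).
    by rewrite mem_undup; apply/mapP; exists (a, b, c).
  have n0 : 0 < a * b * c by rewrite !muln_gt0 !prime_gt0.
  apply/allpairsP; exists ((a, b), c); split=> //;
    rewrite ?mem_primes ?pc ?n0 ?dvdn_mull //.
  apply/allpairsP; exists (a, b); split; rewrite // mem_primes ?pa ?pb n0 /=.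
    by rewrite dvdn_mulr // dvdn_mulr.
  by rewrite dvdn_mulr // dvdn_mull.
apply: leq_trans (uniq_leq_size us sub) _.
rewrite size_flatten sumnE /shape /l !big_map.
apply: (@leq_trans (\sum_(m <- S) 27)); last by rewrite big_const_seq count_predT
  iter_addn_0.
rewrite [leqLHS]big_seq [leqRHS]big_seq; apply: leq_sum => m.
rewrite mem_undup => /mapP[t /ps[h1 h2 h3] ->].
have := size_primes3 _ _ _ h1 h2 h3; set k := size _ => k3.
by rewrite !size_allpairs -/k -[27]/(3 * 3 * 3) !leq_mul.
Qed.

(** Any failure would make the odd prime [r] divide 2a, hence the larger prime a. The last
    conclusion is what separates q from r. *)
Lemma cherries_distinct (A : seq nat) r a b c :
  prime r -> 2 < r -> (forall p, p \in A -> prime p /\ r < p) ->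
  (a, b, c) \in cherries A r -> [/\ a <> b, a <> c, b <> c & ~~ (r %| b + c)].
Proof.
move=> pr r2 hA; rewrite mem_cherries =>
  /and5P[/hA[pa ra] /hA[pb rb] /hA[pc rc] dab /andP[dac /eqP bc]].
have nd p : prime p -> r < p -> ~~ (r %| p + p).
  move=> pp rp; rewrite addnn -mul2n Euclid_dvdM // !dvdn_prime2 //.
  by rewrite (gtn_eqF r2) (ltn_eqF rp).
split=> //.
- by move=> e; move: dab; rewrite -e (negPf (nd _ pa ra)).
- by move=> e; move: dac; rewrite -e (negPf (nd _ pa ra)).
apply/negP => dbc; have /negP[] := nd _ pa ra.
have : r %| (a + b) + (a + c) by rewrite dvdn_add.
by rewrite addnACA dvdn_addl.
Qed.

Lemma cherry_parent (A : seq nat) r a b c :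
  prime r -> 2 < r -> (forall p, p \in A -> prime p /\ r < p) ->
  (forall p p', p \in A -> p' \in A -> p + p' <= r * r) ->
  (a, b, c) \in cherries A r ->
  [/\ prime (max_pdiv (b + c)), max_pdiv (b + c) <> r &
      C3_parent (max_pdiv (b + c) * r ^ 2) (a * b * c)].
Proof.
move=> pr r2 hA rA abc; have [ab ac bc nd] := cherries_distinct _ _ _ _ _ pr r2 hA abc.
move: abc; rewrite mem_cherries => /and5P[aA bA cA dab /andP[dac _]].
have [[pa _] [pb _] [pc _]] := And3 (hA _ aA) (hA _ bA) (hA _ cA).
have mr p p' : p \in A -> p' \in A -> r %| p + p' -> max_pdiv (p + p') = r.
  move=> pA p'A /dvdnP[k e]; have := rA _ _ pA p'A; rewrite e mulnC.
  have := prime_gt0 (hA _ pA).1; have := prime_gt0 pr => r0 p0 le.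
  rewrite max_pdiv_mul //; rewrite leq_pmul2l // in le; rewrite le andbT.
  by have : 0 < k * r by [rewrite -e addn_gt0 p0]; rewrite muln_gt0 => /andP[].
have C : C3 (a * b * c) by exists a, b, c; split.
split.
- by rewrite max_pdiv_prime // (leq_trans (prime_gt1 pb)) // leq_addr.
- by move=> e; move: nd; rewrite -[X in X %| _]e max_pdiv_dvd.
split=> //; split; first by left.
by rewrite wE // (mr a b) // (mr a c) // mulnn mulnC.
Qed.

(** Pigeonhole on the largest prime factor of the sum of the leaves, which lies in [D]; passing from
    triples to distinct products costs the factor 27. *)
Lemma exists_many_parents (A : seq nat) (D : seq nat) r :
  prime r -> 2 < r -> uniq A -> (forall p, p \in A -> prime p /\ r < p) ->
  (forall p p', p \in A -> p' \in A -> p + p' <= r * r) ->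
  uniq D -> (forall q p p', p \in A -> p' \in A -> prime q -> q <= p + p' -> q \in D) ->
  0 < size (cherries A r) ->
  exists q S, [/\ q \in D, prime q, q <> r, uniq S &
    (forall m, m \in S -> C3_parent (q * r ^ 2) m /\
       exists p1 p2 p3, [/\ p1 \in A, p2 \in A, p3 \in A & m = p1 * p2 * p3]) /\
    size (cherries A r) <= size D * (27 * size S)].
Proof.
move=> pr r2 uA hA rA uD hD c0.
pose f (t : nat * nat * nat) := max_pdiv (t.1.2 + t.2).
have fD : all (fun t => f t \in D) (cherries A r).
  apply/allP => -[[a b] c] abc; have [pq _ _] := cherry_parent _ _ _ _ _ pr r2 hA rA abc.
  move: abc; rewrite mem_cherries => /and5P[aA bA cA _ _].
  apply: (hD _ b c) => //; rewrite max_pdiv_leq // addn_gt0.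
  by rewrite prime_gt0 ?(hA _ bA).1.
have [q qD le] := pigeonhole _ _ f D uD fD c0.
pose s := [seq t <- cherries A r | f t == q].
have s0 : 0 < size s.
  by rewrite size_filter; move: (leq_trans c0 le); rewrite muln_gt0 => /andP[].
have sP a b c : (a, b, c) \in s -> [/\ a \in A, b \in A, c \in A, (a, b, c) \in
  cherries A r & max_pdiv (b + c) = q].
  rewrite mem_filter => /andP[/eqP e abc]; split=> //; move: abc; rewrite mem_cherries;
    by case/and4P.
(* Primality of [q] and [q <> r] are read off from one triple of the fibre. *)
have [t0 t0s] : exists t, t \in s by case: (s) s0 => // t s' _; exists t; rewrite mem_head.
exists q, (undup [seq t.1.1 * t.1.2 * t.2 | t <- s]).
case: t0 t0s => [[a b] c] /sP[_ _ _ /(cherry_parent _ _ _ _ _ pr r2 hA rA)[pq nq _] e].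
rewrite e in pq nq.
split=> //; first exact: undup_uniq.
split.
  move=> m; rewrite mem_undup => /mapP[[[a' b'] c']
    /sP[aA bA cA /(cherry_parent _ _ _ _ _ pr r2 hA rA)[_ _ P] <-] ->].
  by split=> //; exists a', b', c'.
apply: leq_trans le _; rewrite leq_mul2l -size_filter; apply/orP; right.
apply: size_prime_triples; first by rewrite filter_uniq // cherries_uniq.
by move=> [[a' b'] c'] /sP[/hA[? _] /hA[? _] /hA[? _] _ _].
Qed.

End Cherries.

(** * Chebyshev's estimates *)

Section Chebyshev.
Local Open Scope nat_scope.

Lemma prime_dvd_fact p n : prime p -> (p %| n`!) = (p <= n).
Proof.
move=> pp; elim: n => [|n IH]; first by rewrite fact0 dvdn1 leqn0 !gtn_eqF ?prime_gt1
  ?prime_gt0.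
rewrite factS Euclid_dvdM // IH [RHS]leq_eqVlt ltnS; apply/idP/idP.
  case/orP=> [/dvdn_leq h|->]; last by rewrite orbT.
  by have := h isT; rewrite leq_eqVlt ltnS.
by case/orP=> [/eqP ->|->]; rewrite ?dvdnn ?orbT.
Qed.

Lemma prod_primes_dvd (s : seq nat) n : uniq s -> all prime s ->
  all (fun p => p %| n) s -> \prod_(p <- s) p %| n.
Proof.
elim: s => [|p s IH] /=; first by rewrite big_nil dvd1n.
case/andP=> ps us /andP[pp prs] /andP[pn sn]; rewrite big_cons Gauss_dvd ?pn ?IH //.
rewrite prime_coprime //; apply/negP => pd.
have [q qs /eqP pq] : exists2 q, q \in s & p == q.
  elim: s pd prs {IH ps us sn} => [|q s IH];
    first by rewrite big_nil dvdn1 gtn_eqF ?prime_gt1.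
  rewrite big_cons Euclid_dvdM // => /orP[pq|/IH h] /= /andP[pq' prs].
    by exists q; rewrite ?mem_head // -dvdn_prime2.
  by have [q' h1 h2] := h prs; exists q' => //; rewrite inE h1 orbT.
by move: ps; rewrite pq qs.
Qed.

(** The two middle coefficients are equal and both occur in the expansion of 2^(2m+1). *)
Lemma bin_odd_le m : 'C(m.*2.+1, m) <= 4 ^ m.
Proof.
have e : 'C(m.*2.+1, m) + 'C(m.*2.+1, m.+1) <= 2 ^ m.*2.+1.
  rewrite -[2]/(1 + 1) expnDn.
  under eq_bigr do rewrite !exp1n !muln1.
  have h1 : m < m.*2.+2 by lia.
  have h2 : m.+1 < m.*2.+2 by lia.
  rewrite (bigD1 (Ordinal h1)) //= (bigD1 (Ordinal h2)) //=;
    first by rewrite addnA leq_addr.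
  by rewrite -val_eqE /= gtn_eqF.
have e2 : 'C(m.*2.+1, m.+1) = 'C(m.*2.+1, m).
  by rewrite -[RHS]bin_sub; [congr 'C(_, _); lia|lia].
by move: e; rewrite e2 expnS -mul2n expnM addnn -mul2n leq_pmul2l.
Qed.

(** Erdős's induction: a composite n adds no factor, and for an odd prime n = 2m + 1 the primes in
    (m + 1, 2m + 1] all divide the binomial coefficient bounded in [bin_odd_le]. *)
Lemma primorial_le n : \prod_(0 <= p < n.+1 | prime p) p <= 4 ^ n.
Proof.
have [k] := ubnP n; elim: k n => // k IH n; rewrite ltnS => nk.
have [n2|n2] := leqP n 2.
  by case: n n2 {nk} => [|[|[|]]] // _; rewrite !big_mkcond /= !big_nat_recr //= big_geq.
have [pn|pn] := boolP (prime n); last first.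
  rewrite big_mkcond big_nat_recr //= (negPf pn) muln1 -big_mkcond.
  case: n nk n2 pn => // n nk n2 _; apply: leq_trans (IH n nk) _.
  by rewrite leq_exp2l.
have [m e] : exists m, n = m.*2.+1.
  exists n./2; rewrite -[LHS]odd_double_half.
  by case: (even_prime pn) n2 => [-> //|-> _].
rewrite e in nk n2 pn *; have m0 : 0 < m by lia.
rewrite (@big_cat_nat _ _ _ m.+2) //=; [|lia].
have -> : 4 ^ m.*2.+1 = 4 ^ m.+1 * 4 ^ m by rewrite -expnD; congr (4 ^ _); lia.
apply: leq_mul; first by apply: IH; lia.
apply: leq_trans (bin_odd_le m); apply: dvdn_leq; first by rewrite bin_gt0; lia.
rewrite -big_filter; apply: prod_primes_dvd.
- by rewrite filter_uniq // iota_uniq.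
- by apply/allP => p; rewrite mem_filter => /andP[].
apply/allP => p; rewrite mem_filter mem_index_iota => /and3P[pp h1 h2].
have hm : m <= m.*2.+1 by lia.
have := bin_fact hm; rewrite (_ : _ - m = m.+1); last by lia.
move/(congr1 (fun k => p %| k)); rewrite Euclid_dvdM // (Euclid_dvdM m`! m.+1`!) //
  !prime_dvd_fact //.
by rewrite (h2 : p <= m.*2.+1) => /or3P[//|h|h]; lia.
Qed.


(** Induction through (m + 1) C(2m + 2, m + 1) = 2 (2m + 1) C(2m, m). *)
Lemma central_bin_ge n : 0 < n -> 4 ^ n <= 2 * n * 'C(2 * n, n).
Proof.
case: n => // n _; elim: n => // n IH.
set m := n.+1 in IH *; set B := 'C(2 * m, m) in IH; set B' := 'C(2 * m.+1, m.+1).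
have h1 : m.+1 * B' = (2 * m).+2 * 'C((2 * m).+1, m).
  by rewrite mul_bin_diag /B' mulnS.
have h2 : m.+1 * 'C((2 * m).+1, m) = (2 * m).+1 * B.
  have -> : m.+1 = (2 * m).+1 - m by lia.
  by rewrite -mul_bin_down.
rewrite expnS; have : m.+1 * (m.+1 * B') =
  (2 * m).+2 * ((2 * m).+1 * B) by rewrite h1 -h2; lia.
clearbody B B' m => e {h1 h2}.
have e3 : m.+1 * B' = 2 * (2 * m).+1 * B.
  apply/eqP; rewrite -(eqn_pmul2l (ltn0Sn m)); apply/eqP; rewrite e; lia.
have : (2 * m).+1 * (4 * 4 ^ m) <= (2 * m).+1 * (2 * m.+1 * B').
  rewrite -(mulnA 2) e3; nia.
by rewrite leq_pmul2l.
Qed.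

(** * Prime factorization of the central binomial coefficient *)

Section CentralBinomial.
Context (n : nat).
Let N := 'C(2 * n, n).

Lemma logn_central_bin p : prime p -> 
  logn p N = \sum_(1 <= k < (2 * n).+1) (2 * n %/ p ^ k - 2 * (n %/ p ^ k)).
Proof.
move=> pp; have := bin_fact (leq_addr n n : n <= n + n).
rewrite addnn -mul2n -/N (_ : 2 * n - n = n); last by lia.
move/(congr1 (logn p)); rewrite !lognM ?muln_gt0 ?fact_gt0 ?bin_gt0 //; last by lia.
rewrite !logn_fact // => e.
have z : \sum_(1 <= k < (2 * n).+1) n %/ p ^ k = \sum_(1 <= k < n.+1) n %/ p ^ k.
  rewrite (@big_cat_nat _ _ _ n.+1) //=; last by lia.
  rewrite -[RHS]addn0; congr (_ + _); rewrite big_nat big1 // => k /andP[h _].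
  by rewrite divn_small // (leq_trans h) // ltnW // ltn_expl // prime_gt1.
have {z}e : logn p N + 2 * \sum_(1 <= k < (2 * n).+1) n %/ p ^ k =
  \sum_(1 <= k < (2 * n).+1) 2 * n %/ p ^ k.
  by rewrite z mul2n -addnn.
rewrite big_distrr /= in e.
apply/eqP; rewrite -(eqn_add2r (\sum_(1 <=
  k < (2 * n).+1) 2 * (n %/ p ^ k))) e -big_split /=.
apply/eqP; apply: eq_bigr => k _; rewrite subnK //.
by rewrite leq_divRL ?expn_gt0 ?prime_gt0 // -mulnA leq_mul2l leq_divM.
Qed.

(** In Legendre's formula each term is at most 1 and vanishes once p^k > 2n, so the exponent is at
    most the integer logarithm of 2n in base p. *)
Lemma expn_logn_central_bin p : prime p -> 0 < n -> p ^ logn p N <= 2 * n.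
Proof.
move=> pp n0; have p1 := prime_gt1 pp; set e := trunc_log p (2 * n).
have n20 : 0 < 2 * n by lia.
have pe : p ^ e <= 2 * n by exact: trunc_logP.
apply: leq_trans pe; rewrite leq_exp2l // logn_central_bin //.
have e2 : e < 2 * n by apply: leq_trans (trunc_logP p1 n20); exact: ltn_expl.
rewrite (@big_cat_nat _ _ _ e.+1) //=; last by lia.
rewrite [X in _ + X]big_nat [X in _ + X]big1 ?addn0 => [|k /andP[ek _]].
  apply: (@leq_trans (\sum_(1 <= k < e.+1) 1)); last by rewrite sum_nat_const_nat; lia.
  apply: leq_sum => k _; set d := p ^ k.
  have d0 : 0 < d by rewrite expn_gt0 ltnW.
  have h := ltn_ceil n d0; suff : 2 * n %/ d < 2 * (n %/ d) + 2 by lia.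
  by rewrite ltn_divLR //; nia.
rewrite divn_small //; apply: leq_trans (trunc_log_ltn (2 * n) p1) _.
by rewrite leq_exp2l.
Qed.

Lemma logn_central_bin_le1 p : prime p -> 0 < n -> 2 * n < p ^ 2 -> logn p N <= 1.
Proof.
move=> pp n0 h; rewrite leqNgt; apply/negP => l2.
have h2 : p ^ 2 <= p ^ logn p N by rewrite leq_exp2l // prime_gt1.
by have := leq_trans h (leq_trans h2 (expn_logn_central_bin p pp n0)); rewrite ltnn.
Qed.

(** Here n/p has integer part 1 and 2n/p has integer part 2, so even the first Legendre term
    vanishes. *)
Lemma logn_central_bin_eq0 p : prime p -> 2 * n < p ^ 2 -> 2 * n < 3 * p -> p <= n ->
  logn p N = 0.
Proof.
move=> pp h1 h2 h3; have p0 := prime_gt0 pp.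
rewrite logn_central_bin // big_nat big1 // => k /andP[k1 _].
case: k k1 => // -[_|k _].
  rewrite expn1; have : 0 < n %/ p by rewrite divn_gt0.
  have : 2 * n %/ p < 3 by rewrite ltn_divLR.
  by lia.
by rewrite divn_small // (leq_trans h1) // leq_exp2l // prime_gt1.
Qed.

Lemma logn_central_bin_gt p : prime p -> 2 * n < p -> logn p N = 0.
Proof.
move=> pp h; rewrite logn_central_bin // big_nat big1 // => k /andP[k1 _].
rewrite divn_small // (leq_trans h) //.
by rewrite -{1}(expn1 p) leq_exp2l ?prime_gt1.
Qed.

(** The three factors come from p <= s, from s < p <= 2n/3 (exponent at most 1, bounded by the
    primorial), and from n < p <= 2n; primes in (2n/3, n] above s contribute nothing. *)
Lemma central_bin_le s : 4 < n -> 2 * n < s.+1 ^ 2 ->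
  N <= (2 * n) ^ s * 4 ^ (2 * n %/ 3) * (2 * n) ^ size [seq p <- iota n.+1 n | prime p].
Proof.
move=> n4 hs; have n0 : 0 < n by lia.
have N0 : 0 < N by rewrite bin_gt0; lia.
set t := 2 * n %/ 3.
have -> : N = \prod_(0 <= p < (2 * n).+1 | prime p) p ^ logn p N.
  rewrite {1}(prod_prime_decomp N0) prime_decompE big_map /=.
  rewrite -[RHS]big_filter.
  rewrite [RHS](bigID (fun p => p \in primes N)) /= [X in _ = _ * X]big1_seq ?muln1;
    last first.
    by move=> p /andP[h _]; rewrite -logn_gt0 -leqNgt leqn0 in h; rewrite (eqP h).
  rewrite -[RHS]big_filter; apply: perm_big; apply: uniq_perm.
  - exact: primes_uniq.
  - by rewrite !filter_uniq // iota_uniq.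
  move=> p; rewrite !mem_filter mem_iota.
  case: (boolP (p \in primes N)) => //= h.
  have pp : prime p by move: h; rewrite mem_primes => /andP[].
  rewrite pp prime_gt0 // add1n ltnS leqNgt;
    apply/esym/negP => /(logn_central_bin_gt p pp) e.
  by move: h; rewrite -logn_gt0 e.
have -> : (2 * n).+1 = n.+1 + n by lia.
rewrite (@big_cat_nat _ _ _ n.+1) ?leq_addr //=.
have expE (P : pred nat) r : \prod_(p <- r | P p) (2 * n) = (2 * n) ^ count P r.
  by rewrite big_const_seq iter_muln_1.
apply: leq_mul; last first.
  rewrite size_filter -[iota _ _](_ : index_iota n.+1 (n.+1 + n) = _);
    last by rewrite /index_iota addKn.
  by rewrite -expE; apply: leq_prod => p pp; exact: expn_logn_central_bin.
apply: (@leq_trans (\prod_(0 <= p < n.+1 | prime p)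
    ((if p <= s then 2 * n else 1) * (if p <= t then p else 1)))).
  rewrite big_nat_cond [leqRHS]big_nat_cond; apply: leq_prod => p /andP[/andP[_ pn] pp].
  rewrite ltnS in pn; have p0 := prime_gt0 pp.
  have [ps|sp] := leqP p s.
    apply: leq_trans (expn_logn_central_bin p pp n0) _.
    by rewrite leq_pmulr //; case: ifP.
  have p2 : 2 * n < p ^ 2 by apply: leq_trans hs _; rewrite leq_exp2r.
  rewrite mul1n; have [pt|tp] := leqP p t.
    by rewrite -[leqRHS]expn1 leq_pexp2l // logn_central_bin_le1.
  by rewrite logn_central_bin_eq0 //; rewrite /t in tp; lia.
rewrite big_split /= -!big_mkcondr /=; apply: leq_mul.
  rewrite expE leq_exp2l; last by lia.
  rewrite -size_filter -[leqRHS](size_iota 1); apply: uniq_leq_size.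
    by rewrite filter_uniq // iota_uniq.
  move=> p; rewrite mem_filter mem_iota => /andP[/andP[/prime_gt0 h1 h2] _].
  by rewrite h1 add1n ltnS.
apply: leq_trans (primorial_le t).
rewrite [leqRHS](@big_nat_widen _ _ _ _ _ n.+1) //.
by rewrite /t; lia.
Qed.

End CentralBinomial.

Lemma prime_count_interval_ge n s : 4 < n -> 2 * n < s.+1 ^ 2 ->
  4 ^ n <= 2 * n * ((2 * n) ^ s * 4 ^ (2 * n %/ 3) *
                    (2 * n) ^ size [seq p <- iota n.+1 n | prime p]).
Proof.
move=> n4 hs; have n0 : 0 < n by lia.
by apply: leq_trans (central_bin_ge n n0) _; rewrite leq_mul2l central_bin_le // orbT.
Qed.

(** At least pi(n) - s primes up to n exceed s, and their product is at most the primorial. *)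
Lemma prime_count_le n s : 0 < s ->
  s ^ (size [seq p <- iota 0 n.+1 | prime p] - s) <= 4 ^ n.
Proof.
move=> s0; apply: leq_trans (primorial_le n).
set l := [seq p <- iota 0 n.+1 | prime p].
apply: (@leq_trans (s ^ count (fun p => s < p) l)).
  rewrite leq_pexp2l // leq_subLR -(count_predC (fun p => s < p) l) addnC leq_add2r.
  rewrite -size_filter -[leqRHS](size_iota 1); apply: uniq_leq_size.
    by rewrite !filter_uniq // iota_uniq.
  move=> p; rewrite !mem_filter !mem_iota /= -leqNgt => /and3P[ps /prime_gt0 h1 _].
  by rewrite h1 add1n ltnS.
have -> : s ^ count (fun p => s < p) l = \prod_(p <- l | s < p) s.
  by rewrite big_const_seq iter_muln_1.
have -> : \prod_(0 <= p < n.+1 | prime p) p = \prod_(p <- l) p by rewrite big_filter.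
rewrite [leqRHS](bigID (fun p => s < p)) /=.
apply: (@leq_trans (\prod_(p <- l | s < p) p)).
  by apply: leq_prod => p /ltnW.
rewrite leq_pmulr // big_seq_cond prodn_cond_gt0 // => p /andP[].
by rewrite mem_filter => /andP[/prime_gt0].
Qed.

End Chebyshev.

(** * Asymptotic bounds for counts of primes *)

Section PrimeCounting.
Context {R : realType}.
Implicit Types x C : R.
Local Open Scope classical_set_scope.

Lemma near_ln_ge C : \forall x \near +oo, C <= ln x.
Proof.
near=> x; have h : expR C <= x by near: x; apply: nbhs_pinfty_ge; exact: num_real.
by rewrite -[leLHS]expRK ler_ln // ?posrE ?expR_gt0 // (lt_le_trans (expR_gt0 C)).
Unshelve. all: by end_near. Qed.

(** With m = 2(k + 1), sqrt x = exp(ln x / m)^(k+1) >= (ln x / m)^(k+1), which has one power of ln x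
    to spare. *)
Lemma near_ln_exp_le C k : \forall x \near +oo, C * ln x ^+ k <= Num.sqrt x.
Proof.
pose m : R := 2 * k.+1%:R.
have m0 : 0 < m by rewrite mulr_gt0 // ltr0n.
near=> x; have x0 : 0 < x by near: x; apply: nbhs_pinfty_gt; exact: num_real.
have hL : `|C| * m ^+ k.+1 <= ln x by near: x; exact: near_ln_ge.
set L := ln x in hL *.
have L0 : 0 <= L by apply: le_trans hL; rewrite mulr_ge0 // exprn_ge0 // ltW.
have sx : Num.sqrt x = expR (L / m) ^+ k.+1.
  rewrite -expRM_natl -{1}(lnK x0) -/L.
  have -> : expR L = expR (k.+1%:R * (L / m)) ^+ 2.
    rewrite -expRM_natl; congr expR; rewrite /m; field.
    by rewrite addrC natr1 pnatr_eq0.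
  by rewrite sqrtr_sqr ger0_norm ?expR_ge0.
have h1 : (L / m) ^+ k.+1 <= Num.sqrt x.
  rewrite sx lerXn2r ?nnegrE ?expR_ge0 ?divr_ge0 ?(ltW m0) //.
  by apply: le_trans (expR_ge1Dx _); rewrite lerDr.
have mk : 0 < m ^+ k.+1 by rewrite exprn_gt0.
apply: le_trans h1; rewrite expr_div_n ler_pdivlMr //.
have -> : L ^+ k.+1 = L * L ^+ k by rewrite exprS.
rewrite mulrAC ler_wpM2r ?exprn_ge0 //; apply: le_trans hL.
by rewrite ler_wpM2r ?(ltW mk) // ler_norm.
Unshelve. all: by end_near. Qed.

Lemma prime_count_dyadic_ge : exists2 c : R, 0 < c &
  \forall x \near +oo, c * (x / ln x) <=
    (size [seq p <- iota (Num.truncn x).+1 (Num.truncn x) | prime p])%:R.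
Proof.
exists (1 / 24) => //; near=> x.
have x10 : 10 <= x by near: x; apply: nbhs_pinfty_ge; exact: num_real.
have L1 : 1 <= ln x by near: x; exact: near_ln_ge.
have Ls : 100 * ln x ^+ 1 <= Num.sqrt x by near: x; exact: near_ln_exp_le.
rewrite expr1 in Ls; set n := Num.truncn x; set N := size _; set L := ln x in L1 Ls *.
have x0 : 0 <= x by lra.
have /andP[nx xn] := truncn_itv x0; rewrite -/n in nx xn.
rewrite -natr1 in xn.
have sq : Num.sqrt x ^+ 2 = x by rewrite sqr_sqrtr.
set y := Num.sqrt x in Ls sq; have y0 : 0 <= y by exact: sqrtr_ge0.
(* Then (s + 1)^2 > 4x >= 2n, while the s small primes cost only O(sqrt x log x) after taking
   logarithms. *)
pose s := Num.truncn (2 * y).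
have /andP[sy ys] : s%:R <= 2 * y < s.+1%:R by apply: truncn_itv; lra.
have n4 : (4 < n)%N by rewrite -(ltr_nat R); lra.
have hs : (2 * n < s.+1 ^ 2)%N.
  rewrite -(ltr_nat R) natrM natrX; apply: (@le_lt_trans _ _ ((2 * y) ^+ 2));
    first by rewrite exprMn sq; lra.
  by rewrite ltrXn2r //; lra.
have := prime_count_interval_ge n s n4 hs; rewrite -/N -(ler_nat R).
have n0 : 0 < n%:R :> R by lra.
have n20 : 0 < (2 * n)%:R :> R by rewrite natrM mulr_gt0.
have e4 k : 0 < 4 ^+ k :> R by rewrite exprn_gt0.
rewrite !natrM !natrX -natrM => h.
have {h} : ln (4 ^+ n : R) <= ln ((2 * n)%:R * ((2 * n)%:R ^+ s * 4 ^+ (2 * n %/ 3) *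
  (2 * n)%:R ^+ N)).
  by rewrite ler_ln // posrE // !mulr_gt0 // exprn_gt0.
have p4 : 0 < 4 :> R by [].
rewrite !lnM ?posrE ?mulr_gt0 ?exprn_gt0 // (lnXn n p4) (lnXn (2 * n %/ 3) p4).
rewrite (lnXn s n20) (lnXn N n20) -!(mulr_natl (ln _)).
set l4 := ln 4; set l := ln (2 * n)%:R => h.
have l41 : 1 <= l4.
  rewrite -[leLHS]expRK ler_ln ?posrE ?expR_gt0 //.
  have e2 : expR 1 = (expR (- 2^-1) ^+ 2)^-1 :> R.
    by rewrite -expRM_natl -expRN; congr expR; field.
  rewrite e2 -[leRHS]invrK lef_pV2 ?posrE ?exprn_gt0 ?expR_gt0 //.
  apply: (@le_trans _ _ (2^-1 ^+ 2)); first by rewrite le_eqVlt; apply/orP; left;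
    apply/eqP; field.
  rewrite lerXn2r ?nnegrE ?expR_ge0 //; apply: le_trans (expR_ge1Dx _); lra.
have l2L : l <= 2 * L.
  rewrite mulr_natl /L -lnXn; last by lra.
  rewrite ler_ln ?posrE ?exprn_gt0 ?natrM //; [|lra].
  by rewrite expr2; apply: ler_pM; lra.
have t3 : (2 * n %/ 3)%:R <= 2 / 3 * n%:R :> R.
  have : (2 * n %/ 3 * 3)%:R <= (2 * n)%:R :> R by rewrite ler_nat leq_divM.
  by rewrite !natrM; lra.
have N0 : 0 <= N%:R :> R by [].
have s0 : 0 <= s%:R :> R by [].
(* The primorial uses up two thirds of n log 4; the remaining third must come from the other
   primes. *)
have h1 : n%:R / 3 * l4 <= (1 + s%:R + N%:R) * l.
  have := ler_wpM2r (_ : 0 <= l4) t3; move/(_ (ltac:(lra))); lra.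
have h2 : n%:R / 3 <= n%:R / 3 * l4 by rewrite -[leLHS]mulr1 ler_wpM2l //; lra.
have h3 : (1 + s%:R + N%:R) * l <= (1 + s%:R + N%:R) * (2 * L) by rewrite ler_wpM2l //; lra.
rewrite mulrA ler_pdivrMr; last by lra.
have h4 : (1 + s%:R) * (2 * L) <= (3 * y) * (2 * (y / 100)).
  by apply: ler_pM; lra.
have h5 : (3 * y) * (2 * (y / 100)) = 6 / 100 * x by rewrite -sq; field.
nra.
Unshelve. all: by end_near. Qed.

Lemma prime_count_le_div_ln : exists2 C : R, 0 < C &
  \forall x \near +oo, 
    (size [seq p <- iota 0 (Num.truncn x).+1 | prime p])%:R <= C * (x / ln x).
Proof.
exists 8 => //; near=> x.
have x10 : 10 <= x by near: x; apply: nbhs_pinfty_ge; exact: num_real.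
have L1 : 1 <= ln x by near: x; exact: near_ln_ge.
have Ls : 2 * ln x ^+ 1 <= Num.sqrt x by near: x; exact: near_ln_exp_le.
rewrite expr1 in Ls; set n := Num.truncn x; set N := size _; set L := ln x in L1 Ls *.
have x0 : 0 <= x by lra.
have /andP[nx xn] := truncn_itv x0; rewrite -/n in nx xn.
have sq : Num.sqrt x ^+ 2 = x by rewrite sqr_sqrtr.
set y := Num.sqrt x in Ls sq; have y0 : 0 <= y by exact: sqrtr_ge0.
(* A cut just above sqrt x: each larger prime has logarithm at least L/2, and the s primes discarded
   are negligible. *)
pose s := (Num.truncn y).+1.
have /andP[sy ys] : (Num.truncn y)%:R <= y < s%:R by apply: truncn_itv.
have sy1 : s%:R <= y + 1 by rewrite /s -natr1; lra.
have s0 : 0 < s%:R :> R by rewrite ltr0n.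
have := prime_count_le n s isT; rewrite -/N -(ler_nat R) !natrX => h.
have {h} : ln (s%:R ^+ (N - s) : R) <= ln (4 ^+ n).
  by rewrite ler_ln // posrE exprn_gt0.
have p4 : 0 < 4 :> R by [].
rewrite (lnXn _ s0) (lnXn _ p4) -!(mulr_natl (ln _)) => h.
have l43 : ln 4 <= 3 :> R by have := @le_ln1Dx R 3; rewrite (_ : 1 + 3 = 4); [apply;
  lra|lra].
have Lls : L / 2 <= ln (s%:R : R).
  have : L <= ln (s%:R ^+ 2 : R).
    have xp : 0 < x by lra.
    rewrite ler_ln ?posrE ?exprn_gt0 //.
    by rewrite -sq lerXn2r ?nnegrE // ltW.
  by rewrite (lnXn _ s0) -mulr_natl; lra.
have NB : N%:R <= (N - s)%:R + s%:R :> R by rewrite -natrD ler_nat addnC -leq_subLR.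
have k0 : 0 <= (N - s)%:R :> R by [].
have h1 : (N - s)%:R * (L / 2) <= (N - s)%:R * ln (s%:R : R) by rewrite ler_wpM2l.
have h2 : n%:R * ln 4 <= x * 3 :> R by apply: ler_pM => //; rewrite ln_ge0 //; lra.
rewrite mulrA ler_pdivlMr; last by lra.
have h3 : (y + 1) * L <= (2 * y) * (y / 2) by apply: ler_pM; lra.
have h4 : (2 * y) * (y / 2) = x by rewrite -sq; field.
have h5 : s%:R * L <= (y + 1) * L by rewrite ler_wpM2r //; lra.
nra.
Unshelve. all: by end_near. Qed.

End PrimeCounting.

(** * Conclusion *)

(** Let U be the pair count and T the number of cherries. The small variance gives U >= Z^2/(4 rho),
    and Cauchy-Schwarz over centres gives U^2 <= Z (T + U). Since 8 rho <= Z yields U >= 2Z, the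
    term Z U is absorbed, leaving U^2 <= 2 Z T. *)
Lemma size_cherries_ge {F : realFieldType} (A : seq nat) r (rho : F) :
  uniq A -> (0 < r)%N -> 0 < rho -> r%:R <= 2 * rho -> 8 * rho <= (size A)%:R ->
  variance A r <= (size A)%:R ^+ 2 / (4 * rho) ->
  (size A)%:R ^+ 3 / (32 * rho ^+ 2) <= (size (cherries A r))%:R.
Proof.
move=> uA r0 rho0 rle rhoZ hV.
have := sum_pairs_ge (F := F) A r r0.
set Z : F := (size A)%:R in rhoZ hV *; set U := \sum_(n <- A) _ => hU.
have Z0 : 0 < Z by lra.
have r0' : 0 < r%:R :> F by rewrite ltr0n.
have UE : U = \sum_(a <- A) (count (fun b => r %| a + b)%N A)%:R.
  rewrite /U; apply: eq_bigr => a _; rewrite -sum1_count natr_sum [RHS]big_mkcond /=.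
  by apply: eq_bigr => b _; case: ifP.
have := congr1 (fun k => k%:R : F) (size_cherries A r uA).
rewrite /= natrD !natr_sum -UE => hT.
have := sqr_sum_le _ A (fun a => (count (fun b => r %| a + b)%N A)%:R : F).
rewrite -UE -/Z.
have -> : \sum_(i <- A) (count (fun b => (r %| i + b)%N) A)%:R ^+ 2 =
   (size (cherries A r))%:R + U.
  by rewrite hT; apply: eq_bigr => a _; rewrite natrX.
set T := (size _)%:R => cs.
have U1 : Z ^+ 2 / (4 * rho) <= U.
  have : Z ^+ 2 / (2 * rho) <= Z ^+ 2 / r%:R.
    rewrite ler_wpM2l ?sqr_ge0 // lef_pV2 ?posrE //; lra.
  have -> : Z ^+ 2 / (2 * rho) = Z ^+ 2 / (4 * rho) + Z ^+ 2 / (4 * rho) by field;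
    rewrite gt_eqF.
  lra.
have U2 : 2 * Z <= U.
  apply: le_trans U1; rewrite ler_pdivlMr ?mulr_gt0 // expr2.
  have := ler_wpM2l (ltW Z0) rhoZ; lra.
have U0 : 0 <= U by lra.
have T1 : U ^+ 2 <= 2 * Z * T by have := ler_wpM2r U0 U2; rewrite -expr2; lra.
have U3 : (Z ^+ 2 / (4 * rho)) ^+ 2 <= U ^+ 2.
  by rewrite lerXn2r ?nnegrE // divr_ge0 ?sqr_ge0 // mulr_ge0 // ltW.
rewrite -(ler_pM2l (_ : 0 < 2 * Z)); last by rewrite mulr_gt0.
apply: le_trans T1; apply: le_trans U3.
by rewrite le_eqVlt; apply/orP; left; apply/eqP; field; rewrite gt_eqF.
Qed.

(** With n the integer part of z, the list covers (n, 2n]; there p >= n + 1 > z and p <= 2n <=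
    2z. *)
Lemma mem_dyadic_primes (R : realType) (z : R) p : 0 <= z ->
  p \in [seq p <- iota (Num.truncn z).+1 (Num.truncn z) | prime p] ->
  prime p /\ z < p%:R <= 2 * z.
Proof.
move=> z0; rewrite mem_filter mem_iota => /and3P[pp h1 h2]; split=> //.
have /andP[t1 t2] := truncn_itv z0.
apply/andP; split; first by apply: lt_le_trans t2 _; rewrite ler_nat.
apply: (@le_trans _ _ (2 * Num.truncn z)%:R); last by rewrite natrM ler_wpM2l.
by rewrite ler_nat mul2n -addnn -ltnS -addSn.
Qed.

(* [L] and [y] stand for [ln x] and [Num.sqrt x]. *)
Lemma exists_modulus_many_cherries (R : archiRealFieldType) (A S : seq nat) (L y c : R) :
  0 < c -> 2 <= L -> 64 / c <= L ->
  8 / c * L ^+ 2 <= y -> 128 / c ^+ 2 * L ^+ 7 <= y -> 2 * L <= y ->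
  uniq A -> (forall p, p \in A -> p%:R <= 2 * y ^+ 2) ->
  uniq S -> (forall r, r \in S -> prime r /\ y * L < r%:R <= 2 * (y * L)) ->
  c * (y ^+ 2 / L) <= (size A)%:R -> c * y <= (size S)%:R ->
  exists2 r, r \in S & c ^+ 3 * y ^+ 4 / (32 * L ^+ 5) <= (size (cherries A r))%:R.
Proof.
move=> c0 L2 Lc y1 y2 y3 uA hA uS hS hZ hs.
have L0 : 0 < L by apply: lt_le_trans L2.
have y0 : 0 < y by apply: lt_le_trans y3; rewrite mulr_gt0.
pose rho := y * L; have rho0 : 0 < rho by rewrite mulr_gt0.
have x0 : 0 < y ^+ 2 by rewrite exprn_gt0.
have cx0 : 0 <= c * (y ^+ 2 / L) / 8 by rewrite !mulr_ge0 ?invr_ge0 // ltW.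
have s0 : 0 < (size S)%:R :> R by apply: lt_le_trans hs; rewrite mulr_gt0.
(* The tent length is about x L^6: then rho^4/K is of order x/L^2, below Z by a factor L, while K
   over the size of [S] is at most of order sqrt x L^6, also smaller than Z. *)
pose B := y ^+ 2 * L ^+ 6.
have xB : 64 * y ^+ 2 <= B.
  rewrite /B [leRHS]mulrC ler_wpM2r ?(ltW x0) //.
  by have -> : 64 = 2 ^+ 6 :> R; [ring|rewrite lerXn2r ?nnegrE // ltW].
have B0 : 0 <= B by apply: le_trans xB; rewrite mulr_ge0 // ltW.
have rB : rho <= B.
  apply: le_trans xB; have : y * L <= y * y.
    by rewrite ler_wpM2l ?(ltW y0) //; clear -y3 L0; lra.
  by rewrite -expr2 -/rho; clear -x0; lra.
have [K KB] : exists K : nat, B < K%:R <= 2 * B.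
  exists (Num.truncn B).+1; have /andP[h1 ->] := truncn_itv B0.
  have B1 : 1 <= B.
    apply: le_trans xB; have : 1 <= y by clear -y3 L2; lra.
    by move=> h; have := ler_pM ler01 ler01 h h; rewrite -expr2; clear; lra.
  by rewrite -natr1 /=; clear -h1 B1; lra.
have /andP[K1 K2] := KB.
have K0 : 0 < K%:R :> R by apply: le_lt_trans K1.
have hK n : n \in A -> (n < K)%N.
  by move/hA => h; rewrite -(ltr_nat R); clear -h K1 xB x0; lra.
have rhoK : rho <= K%:R by apply: le_trans rB (ltW K1).
have small : 8 * K%:R / (size S)%:R + 8 * rho ^+ 4 / K%:R <= (size A)%:R / 4.
  have e1 : 8 * rho ^+ 4 / K%:R <= c * (y ^+ 2 / L) / 8.
    rewrite ler_pdivrMr //.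
    have -> : 8 * rho ^+ 4 = c * (y ^+ 2 / L) / 8 * (64 / c * L ^+ 5 * y ^+ 2).
      by rewrite /rho; field; rewrite !gt_eqF.
    rewrite ler_wpM2l //; apply: le_trans (ltW K1).
    rewrite /B mulrC ler_wpM2l ?(ltW x0) //.
    by rewrite (exprS L 5) ler_wpM2r ?exprn_ge0 // ltW.
  have e2 : 8 * K%:R / (size S)%:R <= c * (y ^+ 2 / L) / 8.
    rewrite ler_pdivrMr //.
    apply: (@le_trans _ _ (16 * B)); first by clear -K2; lra.
    have -> : 16 * B = c * (y ^+ 2 / L) / 8 * (c * (128 / c ^+ 2 * L ^+ 7)).
      by rewrite /B; field; rewrite !gt_eqF.
    by rewrite ler_wpM2l //; apply: le_trans hs; rewrite ler_wpM2l // ltW.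
  by clear -e1 e2 hZ; lra.
have [] := exists_small_variance A S K rho uA hK uS _ rho0 rhoK _ small.
- by move=> r /hS[-> /andP[h1 h2]]; rewrite ltW.
- by rewrite -(ltr0n R).
move=> r rS hV; exists r => //; have [pr /andP[_ r2]] := hS r rS.
have rhoZ : 8 * rho <= (size A)%:R.
  apply: le_trans hZ.
  have -> : 8 * rho = c * (y / L) * (8 / c * L ^+ 2).
    by rewrite /rho; field; rewrite !gt_eqF.
  have -> : c * (y ^+ 2 / L) = c * (y / L) * y by ring.
  by rewrite ler_wpM2l // !mulr_ge0 ?invr_ge0 // ltW.
apply: le_trans (size_cherries_ge A r rho uA (prime_gt0 pr) rho0 r2 rhoZ hV).
rewrite ler_pdivlMr; last by rewrite mulr_gt0 ?exprn_gt0.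
have -> : c ^+ 3 * y ^+ 4 / (32 * L ^+ 5) * (32 * rho ^+ 2) = (c * (y ^+ 2 / L)) ^+ 3.
  by rewrite /rho; field; rewrite gt_eqF.
have cx : 0 <= c * (y ^+ 2 / L) by rewrite !mulr_ge0 ?invr_ge0 // ltW.
by rewrite lerXn2r ?nnegrE.
Qed.

(** Here [D] is the set of primes up to 4x; [4 * x <= r ^ 2] bounds the cofactors by [r], and
    [r <= x] puts [r] below every element of [A]. *)
Lemma exists_parents_of_modulus (R : realType) (x : R) (A : seq nat) r :
  0 <= x -> prime r -> (2 < r)%N -> r%:R <= x -> 4 * x <= r%:R ^+ 2 ->
  uniq A -> (forall p, p \in A -> prime p /\ x < p%:R <= 2 * x) ->
  (0 < size (cherries A r))%N ->
  exists q S, [/\ prime q, q <> r, q%:R <= 4 * x, uniq S &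
    (forall m, m \in S -> C3_parent (q * r ^ 2)%N m /\
       exists p1 p2 p3, [/\ p1 \in A, p2 \in A, p3 \in A & m = (p1 * p2 * p3)%N]) /\
    (size (cherries A r) <=
      size [seq p <- iota 0 (Num.truncn (4 * x)).+1 | prime p] * (27 * size S))%N].
Proof.
move=> x0 pr r2 rx xr uA hA T0; set D := [seq p <- _ | prime p].
have x40 : 0 <= 4 * x by rewrite mulr_ge0.
have /andP[t1 t2] := truncn_itv x40.
have le4 p p' : p \in A -> p' \in A -> (p + p')%:R <= 4 * x.
  by move=> /hA[_ /andP[_ h1]] /hA[_ /andP[_ h2]]; rewrite natrD; clear -h1 h2; lra.
have hAr p : p \in A -> prime p /\ (r < p)%N.
  by move=> /hA[pp /andP[h1 h2]]; split=> //; rewrite -(ltr_nat R) (le_lt_trans rx).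
have hrr p p' : p \in A -> p' \in A -> (p + p' <= r * r)%N.
  by move=> pA p'A; rewrite -(ler_nat R) (le_trans (le4 _ _ pA p'A)) // natrM -expr2.
have memD q : q \in D = prime q && (q <= Num.truncn (4 * x))%N.
  by rewrite mem_filter mem_iota add0n ltnS.
have hD q p p' : p \in A -> p' \in A -> prime q -> (q <= p + p')%N -> q \in D.
  move=> pA p'A pq h; rewrite memD pq /= -ltnS -(ltr_nat R).
  by apply: le_lt_trans t2; apply: le_trans (le4 _ _ pA p'A); rewrite ler_nat.
have uD : uniq D by rewrite filter_uniq // iota_uniq.
have [q [S [qD pq nq uS hS]]] := exists_many_parents A D r pr r2 uA hAr hrr uD hD T0.
exists q, S; split=> //; move: qD; rewrite memD pq /= -(ler_nat R) => /le_trans; exact.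
Qed.

Theorem theorem2 (R : realType) :
  exists c2 x0 : R, 0 < c2 /\
    forall x : R, x0 <= x ->
      exists q r : nat,
        [/\ prime q, prime r & q <> r] /\
        q%:R <= 4 * x /\
        Num.sqrt x * ln x < r%:R <= 2 * Num.sqrt x * ln x /\
        B3 (q * r ^ 2)%N /\
        exists S : seq nat,
          uniq S /\
          (forall m : nat, m \in S ->
             C3_parent (q * r ^ 2)%N m /\
             exists p1 p2 p3 : nat,
               [/\ prime p1, prime p2 & prime p3] /\
               [/\ x < p1%:R <= 2 * x, x < p2%:R <= 2 * x
                 & x < p3%:R <= 2 * x] /\
               m = (p1 * p2 * p3)%N) /\
          c2 * (x / ln x ^+ 4) <= (size S)%:R.
Proof.
have [c c0 lowA] := @prime_count_dyadic_ge R.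
(* The lower bound serves both at x, for [A], and at rho, for [S]; the latter calls for an explicit
   threshold. *)
have [M [_ lowS]] := lowA.
have [C C0 [M' [_ upD]]] := @prime_count_le_div_ln R.
(* There are at least c^3 x^2 / (32 L^5) cherries, at most 4 C x / L values of q, and at most 27
   triples for each product. *)
exists (c ^+ 3 / (128 * 27 * C)).
suff [X [_ H]] : \forall x \near +oo%classic, exists q r : nat,
        [/\ prime q, prime r & q <> r] /\
        q%:R <= 4 * x /\
        Num.sqrt x * ln x < r%:R <= 2 * Num.sqrt x * ln x /\
        B3 (q * r ^ 2)%N /\
        exists S : seq nat,
          uniq S /\
          (forall m : nat, m \in S ->
             C3_parent (q * r ^ 2)%N m /\
             exists p1 p2 p3 : nat,
               [/\ prime p1, prime p2 & prime p3] /\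
               [/\ x < p1%:R <= 2 * x, x < p2%:R <= 2 * x
                 & x < p3%:R <= 2 * x] /\
               m = (p1 * p2 * p3)%N) /\
          c ^+ 3 / (128 * 27 * C) * (x / ln x ^+ 4) <= (size S)%:R.
  exists (X + 1); split; last by move=> x Xx; apply: H; rewrite (lt_le_trans _ Xx) // ltrDl.
  by apply: divr_gt0; [exact: exprn_gt0|apply: mulr_gt0 => //; lra].
near=> x.
have x1 : 1 < x by near: x; apply: nbhs_pinfty_gt; exact: num_real.
have xM' : M' < x by near: x; apply: nbhs_pinfty_gt; exact: num_real.
have L2 : 2 <= ln x by near: x; exact: near_ln_ge.
(* As rho >= 2 ln x, this places rho beyond the threshold [M]. *)
have LM : M + 1 <= ln x by near: x; exact: near_ln_ge.
have Lc : 64 / c <= ln x by near: x; exact: near_ln_ge.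
have y1 : 8 / c * ln x ^+ 2 <= Num.sqrt x by near: x; exact: near_ln_exp_le.
have y2 : 128 / c ^+ 2 * ln x ^+ 7 <= Num.sqrt x by near: x; exact: near_ln_exp_le.
have y3 : 2 * ln x ^+ 1 <= Num.sqrt x by near: x; exact: near_ln_exp_le.
rewrite expr1 in y3.
have hZ : c * (x / ln x) <=
    (size [seq p <- iota (Num.truncn x).+1 (Num.truncn x) | prime p])%:R by near: x.
set A := [seq p <- _ | prime p] in hZ.
have x0 : 0 < x by apply: lt_trans x1.
have sq : Num.sqrt x ^+ 2 = x by rewrite sqr_sqrtr ?(ltW x0).
set L := ln x in L2 LM Lc y1 y2 y3 hZ *.
set y := Num.sqrt x in y1 y2 y3 sq *.
have L0 : 0 < L by apply: lt_le_trans L2.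
have y0 : 0 < y by apply: lt_le_trans y3; rewrite mulr_gt0.
pose rho := y * L; have rho0 : 0 < rho by rewrite mulr_gt0.
have rho_x : 2 * rho <= x.
  by rewrite -sq expr2 /rho mulrCA ler_wpM2l // ltW.
have L_rho : 2 * L <= rho by rewrite ler_wpM2r ?(ltW L0) //; clear -y3 L2; lra.
pose S := [seq p <- iota (Num.truncn rho).+1 (Num.truncn rho) | prime p].
(* Since rho <= x, ln rho <= L, so rho / ln rho >= y. *)
have hs : c * y <= (size S)%:R.
  apply: le_trans (lowS rho _); last by rewrite /=; clear -L_rho LM L2; lra.
  rewrite ler_wpM2l ?(ltW c0) // ler_pdivlMr.
    rewrite /rho ler_wpM2l ?(ltW y0) // ler_ln ?posrE //.
    by rewrite -/rho; clear -rho_x rho0; lra.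
  by rewrite ln_gt0 //; clear -L_rho L2; lra.
have hA p : p \in A -> prime p /\ x < p%:R <= 2 * x.
  by apply: mem_dyadic_primes; exact: ltW.
have hS p : p \in S -> prime p /\ rho < p%:R <= 2 * rho.
  by apply: mem_dyadic_primes; exact: ltW.
have uA : uniq A by rewrite filter_uniq // iota_uniq.
have uS : uniq S by rewrite filter_uniq // iota_uniq.
have hA2 p : p \in A -> p%:R <= 2 * y ^+ 2 by move=> /hA[_ /andP[_]]; rewrite sq.
have hZ2 : c * (y ^+ 2 / L) <= (size A)%:R by rewrite sq.
have [r rS hT] := exists_modulus_many_cherries R A S L y c
  c0 L2 Lc y1 y2 y3 uA hA2 uS hS hZ2 hs.
have [pr /andP[r1 r2]] := hS r rS.
have T0 : (0 < size (cherries A r))%N.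
  rewrite -(ltr0n R); apply: lt_le_trans hT.
  by apply: divr_gt0; apply: mulr_gt0; rewrite ?exprn_gt0.
have r_gt2 : (2 < r)%N.
  by rewrite -(ltr_nat R); apply: le_lt_trans r1; clear -L_rho L2; lra.
(* r^2 > rho^2 = x L^2, and L >= 2. *)
have r_sq : 4 * x <= r%:R ^+ 2.
  have rr : rho ^+ 2 <= r%:R ^+ 2 by rewrite lerXn2r ?nnegrE ?(ltW rho0) ?(ltW r1).
  apply: le_trans rr; rewrite exprMn sq mulrC ler_wpM2l ?(ltW x0) //.
  have := ler_pM (ler0n R 2) (ler0n R 2) L2 L2; rewrite -expr2; clear; lra.
have [q [S' [pq nq qx uS' [hS' le]]]] := exists_parents_of_modulus R x A r
  (ltW x0) pr r_gt2 (le_trans r2 rho_x) r_sq uA hA T0.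
exists q, r; split=> //; split=> //.
split; first by rewrite r1 -mulrA.
split.
  exists q, r, r; split=> //; first by apply: Or33.
    by case.
  by rewrite -mulnn mulnA.
exists S'; split=> //; split.
  move=> m /hS'[P [p1 [p2 [p3 [/hA[? ?] /hA[? ?] /hA[? ?] e]]]]]; split; first exact: P.
  exists p1, p2, p3; split; first by split.
  split; first by split.
  exact: e.
set D := [seq p <- _ | prime p] in le.
have hD : (size D)%:R <= 4 * C * (x / L).
  apply: le_trans (upD (4 * x) _) _; first by rewrite /=; clear -xM' x0; lra.
  rewrite (_ : 4 * C * (x / L) = C * (4 * x / L)); last by ring.
  have L4 : L <= ln (4 * x) by rewrite ler_ln ?posrE ?mulr_gt0 //; clear -x0; lra.
  rewrite ler_wpM2l ?(ltW C0) // ler_wpM2l ?mulr_ge0 ?(ltW x0) //.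
  by rewrite lef_pV2 ?posrE // (lt_le_trans L0).
move: le; rewrite -(ler_nat R) !natrM => le.
have lD : (size D)%:R * (27 * (size S')%:R) <= 4 * C * (x / L) * 27 * (size S')%:R.
  by rewrite [leLHS]mulrA ler_wpM2r // ler_wpM2r.
have := le_trans hT (le_trans le lD).
have -> : c ^+ 3 * y ^+ 4 / (32 * L ^+ 5) =
  4 * C * (x / L) * 27 * (c ^+ 3 / (128 * 27 * C) * (x / L ^+ 4)).
  by rewrite -sq; field; rewrite !gt_eqF.
rewrite ler_pM2l //.
by apply: mulr_gt0 => //; apply: mulr_gt0; [apply: mulr_gt0|apply: divr_gt0].
Unshelve. all: by end_near. Qed.
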